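(* Let $V=V_0+V_1$ with $V_0\in L^\infty(\mathbb{R})$, $\operatorname{ess\,inf}V_0>0$, and $V_1\in\mathcal{M}_1(\mathbb{R})$. Then for each $a\in\mathbb{R}$ there exists $u_a\in K_a$ with $I(u_a;V)=\min_{u\in K_a}I(u;V)$; that is, $F(a;V)=I(u_a;V)$ is attained.
   Context: Elements of $H^1(\mathbb{R})$ are identified with their continuous representatives; $\|u\|_\infty:=\|u\|_{L^\infty(\mathbb{R})}$. $\mathcal{M}_1(\mathbb{R})$ is the set of signed Radon measures on $\mathbb{R}$ with finite total variation. The potential $V=V_0+V_1$ acts as the bilinear form $V(u,v):=\int_{\mathbb{R}}V_0uv\,dx+\int_{\mathbb{R}}uv\,dV_1$ on $H^1(\mathbb{R})$, and $I(u;V):=\|u'\|_{L^2(\mathbb{R})}^2+V(u,u)$. For $a\in\mathbb{R}$, $K_a:=\{u\in H^1(\mathbb{R}):u(a)=\|u\|_\infty=1\}$ and $F(a;V):=\inf_{u\in K_a}I(u;V)$. *)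

(* Defs.v *)
From HB Require Import structures.
From mathcomp Require Import all_boot all_order all_algebra.
From mathcomp Require Import all_classical all_reals all_analysis.
Import Order.TTheory GRing.Theory Num.Theory numFieldNormedType.Exports.

Set Implicit Arguments.
Unset Strict Implicit.
Unset Printing Implicit Defensive.

Local Open Scope classical_set_scope.
Local Open Scope ring_scope.

Notation Rline R := (measurableTypeR R).

Definition hahn_pick (R : realType) (nu : {charge set Rline R -> \bar R}) :
  {P : set (Rline R) | exists N, hahn_decomposition nu P N} :=
  cid (Hahn_decomposition nu).

Definition hahnP (R : realType) (nu : {charge set Rline R -> \bar R}) :=
  proj1_sig (hahn_pick nu).

Definition hahnN_pick (R : realType) (nu : {charge set Rline R -> \bar R}) :
  {N : set (Rline R) | hahn_decomposition nu (hahnP nu) N} :=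
  cid (proj2_sig (hahn_pick nu)).

Definition hahnN (R : realType) (nu : {charge set Rline R -> \bar R}) :=
  proj1_sig (hahnN_pick nu).

Definition hahnPN (R : realType) (nu : {charge set Rline R -> \bar R}) :
  hahn_decomposition nu (hahnP nu) (hahnN nu) := proj2_sig (hahnN_pick nu).

Definition charge_integral (R : realType) (nu : {charge set Rline R -> \bar R})
  (f : R -> R) : R :=
  Rintegral (jordan_pos (hahnPN nu)) setT f
  - Rintegral (jordan_neg (hahnPN nu)) setT f.

(* u is in H^1(R) (continuous representative) with weak derivative u' := g:
   u, g in L^2(R) (Borel measurable, square integrable) and
   u y - u x = \int_[x,y] g  for all x <= y (so u is absolutely continuous). *)
Definition H1_with_deriv (R : realType) (u g : R -> R) : Prop :=
  [/\ measurable_fun [set: Rline R] u,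
      (@lebesgue_measure R).-integrable [set: Rline R] (fun x => ((u x) ^+ 2)%:E),
      measurable_fun [set: Rline R] g,
      (@lebesgue_measure R).-integrable [set: Rline R] (fun x => ((g x) ^+ 2)%:E) &
      forall x y : R, x <= y ->
        u y - u x = Rintegral (@lebesgue_measure R) `[x, y] g].

Definition Vform (R : realType) (V0 : R -> R) (V1 : {charge set Rline R -> \bar R})
  (u v : R -> R) : R :=
  Rintegral (@lebesgue_measure R) setT (fun x => V0 x * u x * v x)
  + charge_integral V1 (fun x => u x * v x).

(* I(u;V) = ||u'||_2^2 + V(u,u), where g is the weak derivative of u. *)
Definition Ifun (R : realType) (V0 : R -> R) (V1 : {charge set Rline R -> \bar R})
  (u g : R -> R) : R :=
  Rintegral (@lebesgue_measure R) setT (fun x => (g x) ^+ 2) + Vform V0 V1 u u.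

(* ||u||_oo for a continuous u (sup of |u|). *)
Definition sup_norm (R : realType) (u : R -> R) : \bar R :=
  ereal_sup [set (`|u x|)%:E | x in [set: R]].

Definition in_Ka (R : realType) (a : R) (u g : R -> R) : Prop :=
  [/\ H1_with_deriv u g, u a = 1 & sup_norm u = 1%E].

(* Main.v *)
(* The direct method without weak compactness. Along a minimizing sequence the
   derivatives are bounded in L^2, hence the functions are equi-Hoelder, and
   Tychonoff's theorem on [-1, 1]^R provides a pointwise cluster point u. Let
   C_n be the convex set of pairs (v, v') with v in K_a that are 2^-n-close to u
   at the first n+1 rationals. By the parallelogram law, near-minimizers on the
   C_n of the convex part E(v) = \int v'^2 + V_0 v^2 have derivatives that form a
   Cauchy sequence in L^2; its limit is the weak derivative of u. By Fatou, E(u)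
   is at most the limit l of the infima of E over C_n, hence at most the liminf
   of E along a minimizing sequence w_n in C_n. The charge V_1 is handled
   by dominated convergence along w_n, which converges to u pointwise because it
   is equi-Hoelder and converges on the rationals. *)
Require Import Defs.
From HB Require Import structures.
From mathcomp Require Import all_boot all_order all_algebra.
From mathcomp Require Import all_classical all_reals all_analysis.
From mathcomp Require Import measurable_realfun ring lra.
Import Order.TTheory GRing.Theory Num.Theory numFieldNormedType.Exports.
Local Open Scope classical_set_scope.
Local Open Scope ring_scope.
Set Implicit Arguments.
Unset Strict Implicit.
Unset Printing Implicit Defensive.

(** * Square-integrable functions and rapidly Cauchy sequences *)

Section L2.
Context {d : measure_display} {T : measurableType d} {R : realType}.
Variable mu : {measure set T -> \bar R}.

Definition L2 (f : T -> R) : Prop :=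
  measurable_fun setT f /\ mu.-integrable setT (fun x => ((f x) ^+ 2)%:E).

Lemma L2_comb (a b : R) (f g : T -> R) :
  L2 f -> L2 g -> L2 (fun x => a * f x + b * g x).
Proof.
move=> [mf If] [mg Ig].
have mfg : measurable_fun setT (fun x => a * f x + b * g x).
  by apply: measurable_funD; exact: measurable_funM.
split=> //.
have J : mu.-integrable setT
    (fun x => ((2 * a ^+ 2)%:E * (f x ^+ 2)%:E + (2 * b ^+ 2)%:E * (g x ^+ 2)%:E)%E).
  by apply: integrableD => //; exact: integrableZl.
apply: le_integrable J => //.
  by apply/measurable_EFinP; exact: measurable_funX.
move=> x _; rewrite -!EFinM -EFinD !abse_EFin lee_fin.
rewrite ger0_norm ?sqr_ge0 // ger0_norm; last first.
  by rewrite addr_ge0// mulr_ge0// ?sqr_ge0// mulr_ge0// sqr_ge0.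
have := sqr_ge0 (a * f x - b * g x); nra.
Qed.

Lemma integrable_scale (D : set T) (a : R) (f : T -> R) : measurable D ->
  mu.-integrable D (EFin \o f) -> mu.-integrable D (EFin \o (fun x => a * f x)).
Proof.
move=> mD If; rewrite (_ : _ \o _ = (fun x => a%:E * (EFin \o f) x)%E).
  exact: integrableZl.
by apply/funext => x.
Qed.

(* AM-GM bounds [\sum_n |h_(n+1) - h_n|] by 1 plus half the sum of the
   [2 ^ n (h_(n+1) - h_n)^2], which is integrable even when [mu] is infinite. *)
Lemma L2_fast_cauchy (h : nat -> T -> R) (B : R) :
  (forall n, measurable_fun setT (h n)) ->
  (forall n, \int[mu]_x ((h n.+1 x - h n x) ^+ 2)%:E <=
             (B * (2^-1 ^+ n) ^+ 2)%:E)%E ->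
  exists (g : T -> R) (S : T -> \bar R),
    [/\ measurable_fun setT g, mu.-integrable setT S,
        \forall x \ae mu, h ^~ x @ \oo --> g x &
        forall n x, (`|h n x - h 0 x|%:E <= S x + 1)%E].
Proof.
move=> mh hB.
have B0 : 0 <= B.
  have := hB 0; rewrite expr0 expr1n mulr1 -lee_fin; apply: le_trans.
  by apply: integral_ge0 => x _; rewrite lee_fin sqr_ge0.
pose t n x := 2^-1 * (2 ^+ n * (h n.+1 x - h n x) ^+ 2).
have t0 n x : 0 <= t n x by rewrite /t mulr_ge0 ?invr_ge0// mulr_ge0 ?sqr_ge0// exprn_ge0.
have mt n : measurable_fun setT (t n).
  apply: measurable_funM => //; apply: measurable_funM => //.
  by apply: measurable_funX; exact: measurable_funB.
pose S x := (\sum_(0 <= n <oo) (t n x)%:E)%E.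
have S0 x : (0 <= S x)%E by apply: nneseries_ge0 => n _ _; rewrite lee_fin.
have mS : measurable_fun setT S.
  apply: (@ge0_emeasurable_sum _ _ _ _ (fun n x => (t n x)%:E) xpredT).
    by move=> n x _ _; rewrite lee_fin.
  by move=> n _; exact/measurable_EFinP.
have half n : series (geometric 1 (2^-1 : R)) n <= 2.
  apply: le_trans (geometric_le_lim n ler01 _ _) _ => //.
    by rewrite ger0_norm; lra.
  by rewrite (_ : 1 - 2^-1 = 2^-1 :> R) ?invrK ?mul1r//; lra.
have IS : mu.-integrable setT S.
  apply/integrableP; split=> //.
  under eq_integral do rewrite gee0_abs//.
  rewrite integral_nneseries//; last by move=> n x _; rewrite lee_fin.
    apply: (@le_lt_trans _ _ (B)%:E); last exact: ltry.
    apply: lime_le.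
      apply: is_cvg_nneseries => n _ _; apply: integral_ge0 => x _.
      by rewrite lee_fin.
    apply: nearW => n.
    (* The factor 4^-k of the hypothesis beats the weight 2^k / 2 of [t k], so the integrals of the
       [t k] sum to at most [B]. *)
    apply: (@le_trans _ _ (\sum_(0 <= k < n) (2^-1 * B * (2^-1 ^+ k))%:E)%E).
      apply: lee_sum => k _.
      rewrite (_ : (fun x => (t k x)%:E) = (fun x => (2^-1 * 2 ^+ k)%:E *
        ((h k.+1 x - h k x) ^+ 2)%:E)%E); last first.
        by apply/funext => x; rewrite -EFinM /t mulrA.
      rewrite ge0_integralZl_EFin ?mulr_ge0 ?invr_ge0 ?exprn_ge0//; last 2 first.
      - by move=> x _; rewrite lee_fin sqr_ge0.
      - apply/measurable_EFinP; apply: measurable_funX.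
        exact: measurable_funB.
      apply: (@le_trans _ _ ((2^-1 * 2 ^+ k)%:E * (B * (2^-1 ^+ k) ^+ 2)%:E)%E).
        apply: lee_wpmul2l; last exact: hB.
        by rewrite lee_fin mulr_ge0 ?invr_ge0// exprn_ge0.
      rewrite -EFinM lee_fin exprVn.
      have p : 2 ^+ k != 0 :> R by rewrite expf_neq0.
      by rewrite le_eqVlt; apply/orP; left; apply/eqP; field.
    rewrite sumEFin lee_fin -mulr_sumr.
    have := half n; rewrite /series/=.
    under eq_bigr do rewrite mul1r.
    move=> Hn; apply: le_trans (ler_wpM2l _ Hn) _; first by lra.
    by lra.
  by move=> n; exact/measurable_EFinP.
have partial n x : \sum_(0 <= k < n) `|h k.+1 x - h k x| <=
    \sum_(0 <= k < n) t k x + 1.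
  apply: (@le_trans _ _ (\sum_(0 <= k < n) (t k x + 2^-1 * 2^-1 ^+ k))).
    apply: ler_sum => k _; rewrite /t exprVn.
    have p : 0 < 2 ^+ k :> R by rewrite exprn_gt0.
    set c := 2 ^+ k in p *; set y := h k.+1 x - h k x.
    rewrite -(real_normK (num_real y)).
    have := sqr_ge0 (c * `|y| - 1) => sq.
    rewrite -(ler_pM2l p).
    rewrite (_ : c * (2^-1 * (c * `|y| ^+ 2) + 2^-1 * c^-1) =
             2^-1 * ((c * `|y|) ^+ 2 + 1)); last by field; rewrite gt_eqF.
    nra.
  rewrite big_split/= lerD2l -mulr_sumr.
  have := half n; rewrite /series/=.
  under eq_bigr do rewrite mul1r.
  by move=> Hn; lra.
have hE x n : h n x - h 0 x = series (telescope (h ^~ x)) n.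
  by rewrite telescopeK.
have le_hS n x : (`|h n x - h 0 x|%:E <= S x + 1)%E.
  apply: (@le_trans _ _ ((\sum_(0 <= k < n) (t k x)%:E) + 1)%E).
    rewrite sumEFin -EFinD lee_fin; apply: le_trans (partial n x).
    by rewrite hE /series/=; exact: ler_norm_sum.
  rewrite leeD2r//; apply: nneseries_lim_ge => k _ _.
  by rewrite lee_fin.
(* The upper limit is measurable without any convergence assumption. It equals the limit wherever
   the sequence converges, which happens wherever [S x] is finite, hence almost everywhere. *)
pose g x := fine (limn_esup (fun n => (h n x)%:E)).
exists g, S; split=> //.
- apply: (measurableT_comp (fine_measurable measurableT)).
  by apply: measurable_fun_limn_esup => n; exact/measurable_EFinP.
- have := integrable_ae measurableT IS; apply: filterS => x /(_ I) Sfin.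
  have : cvgn (h ^~ x).
    have : cvgn (series (telescope (h ^~ x))).
      apply: normed_cvg; apply: nondecreasing_is_cvgn.
        by apply: nondecreasing_series => n _ _; exact: normr_ge0.
      exists (fine (S x) + 1) => _ [n _ <-]; rewrite /series/=.
      apply: le_trans (partial n x) _; rewrite lerD2r.
      rewrite -lee_fin fineK// -sumEFin.
      by apply: nneseries_lim_ge => k _ _; rewrite lee_fin.
    move=> cs; rewrite (_ : h ^~ x = (fun n => h 0 x + series (telescope (h ^~ x)) n)).
      by apply: is_cvgD => //; exact: is_cvg_cst.
    by apply/funext => n; rewrite -hE addrC subrK.
  move=> /cvg_ex[/= l hl].
  suff -> : g x = l by [].
  have /cvg_limn_einf_sup[_ E] : (fun n => (h n x)%:E) @ \oo --> l%:E.
    by apply: cvg_EFin hl; exact: nearW.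
  by rewrite /g E.
Qed.

End L2.

(** By Tychonoff, [f] has a cluster point in [-M, M]^T. For uncountable [T] no subsequence need
    converge; the product topology gives closeness on finite sets, at arbitrarily large indices. *)
Lemma pointwise_cluster (R : realType) (T : eqType) (f : nat -> T -> R) (M : R) :
  (forall n x, `|f n x| <= M) ->
  exists g : T -> R, forall (s : seq T) (e : R) (N : nat), 0 < e ->
    exists2 n, (N <= n)%N & forall x, x \in s -> `|f n x - g x| < e.
Proof.
move=> f1.
have := @tychonoff T (fun=> R : topologicalType) (fun=> `[- M, M]%classic)
  (fun=> @segment_compact R _ _).
set A := [set g | _] => cA.
have FA : (f @ \oo) A.
  by exists 0%N => // n _ x; rewrite /= in_itv/= -ler_norml.
have [g [_ gc]] := cA _ _ FA.
exists g => s e N e0.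
have F1 : (f @ \oo) [set f n | n in [set n | (N <= n)%N]].
  by exists N => // n /= Nn; exists n.
pose G := nbhs (g : prod_topology (fun=> R : topologicalType)).
have FG : Filter G by exact: nbhs_filter.
(* Constraining finitely many coordinates defines a neighbourhood of [g] in the product topology, by
   induction on the list. *)
have F2 : G [set k | forall x, x \in s -> `|k x - g x| < e].
  elim: s => [|y s IHs].
    by apply: (@filterS _ G _ setT); [move=> k _ x|exact: filterT].
  have Hy : G [set k | `|k y - g y| < e].
    have /cvgrPdist_lt/(_ e e0) := @proj_continuous T (fun=> R : topologicalType) y g.
    by apply: filterS => k /=; rewrite distrC.
  apply: filterS (filterI Hy IHs) => k [/= ky ks] x.
  by rewrite in_cons => /orP[/eqP->|/ks].
by have [_ [[n /= Nn <-] Hn]] := gc _ _ F1 F2; exists n.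
Qed.

(** * Bounded convergence for finite measures and charges *)

Section bounded_convergence.
Context {d : measure_display} {T : measurableType d} {R : realType}.
Variable mu : {finite_measure set T -> \bar R}.

Lemma bounded_integrable (M : R) (f : T -> R) :
  measurable_fun setT f -> (forall x, `|f x| <= M) ->
  mu.-integrable setT (EFin \o f).
Proof.
move=> mf fM; apply: measurable_bounded_integrable => //.
  by rewrite ltey_eq fin_num_measure.
exists M; split; first exact: num_real.
by move=> y My x _ /=; apply: le_trans (fM x) (ltW My).
Qed.

Lemma bounded_Rintegral_cvg (M : R) (f : nat -> T -> R) (g : T -> R) :
  (forall n, measurable_fun setT (f n)) -> (forall n x, `|f n x| <= M) ->
  (forall x, f ^~ x @ \oo --> g x) ->
  (fun n => Rintegral mu setT (f n)) @ \oo --> Rintegral mu setT g.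
Proof.
move=> mf fM fg.
have mg : measurable_fun setT g by apply: (measurable_fun_cvg mf) => x _.
have [Ig _ H] : [/\ mu.-integrable setT (EFin \o g),
  [sequence \int[mu]_x `|(f n x)%:E - (g x)%:E|]_n @ \oo --> 0 &
  [sequence \int[mu]_x (f n x)%:E]_n @ \oo --> \int[mu]_x (g x)%:E]%E.
  apply: (@dominated_convergence _ _ _ mu setT measurableT _ _ (cst M%:E)).
  - by move=> n; apply/measurable_EFinP.
  - exact/measurable_EFinP.
  - by apply: aeW => x _; apply: cvg_EFin (fg x); exact: nearW.
  - exact: finite_measure_integrable_cst.
  - by apply: aeW => x n _; rewrite lee_fin.
rewrite /Rintegral; apply: fine_cvg.
by rewrite fineK// integrable_fin_num.
Qed.

Lemma bounded_Rintegral_le (M : R) (f : T -> R) :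
  measurable_fun setT f -> (forall x, `|f x| <= M) ->
  `|Rintegral mu setT f| <= M * fine (mu setT).
Proof.
move=> mf fM; have If := bounded_integrable mf fM.
apply: le_trans (le_normr_Rintegral measurableT If) _.
rewrite -Rintegral_cst//; apply: le_Rintegral => //.
- apply: (@bounded_integrable M) => [|x]; last by rewrite normr_id.
  exact: measurableT_comp.
- exact: finite_measure_integrable_cst.
Qed.

End bounded_convergence.

Section charge_integral.
Context {R : realType}.
Variable nu : {charge set Rline R -> \bar R}.

(** Both Jordan parts are finite measures, so a constant dominates. Convergence is assumed at every
    point because [nu] may charge Lebesgue null sets. *)
Lemma charge_integral_cvg (M : R) (f : nat -> R -> R) (g : R -> R) :
  (forall n, measurable_fun [set: Rline R] (f n)) ->
  (forall n x, `|f n x| <= M) -> (forall x, f ^~ x @ \oo --> g x) ->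
  (fun n => charge_integral nu (f n)) @ \oo --> charge_integral nu g.
Proof.
by move=> mf fM fg; apply: cvgB;
  exact: (@bounded_Rintegral_cvg _ (Rline R) R _ M).
Qed.

(** The bound is uniform in [f]: with [M = 1] it covers all squares of elements of K_a, which keeps
    the functional bounded below and the energies of a minimizing sequence bounded above. *)
Lemma charge_integral_bounded (M : R) : exists C : R, forall f : R -> R,
  measurable_fun [set: Rline R] f -> (forall x, `|f x| <= M) ->
  `|charge_integral nu f| <= C.
Proof.
exists (M * fine (jordan_pos (hahnPN nu) setT) +
        M * fine (jordan_neg (hahnPN nu) setT)) => f mf fM.
apply: le_trans (ler_normB _ _) _.
by apply: lerD; exact: (@bounded_Rintegral_le _ (Rline R)).
Qed.

End charge_integral.

(** * Functions in H^1 of the line *)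

Section sobolev.
Context {R : realType}.
Local Notation mu := (@lebesgue_measure R).

(** The majorant f^2 + 1 of |f| has a finite integral over a bounded interval. This makes the
    integrals of weak derivatives genuine, hence linear in the integrand. *)
Lemma L2_integrable_itv (f : R -> R) (x y : R) :
  L2 mu f -> mu.-integrable `[x, y] (EFin \o f).
Proof.
move=> [mf If].
have J : mu.-integrable `[x, y] (fun z => ((f z ^+ 2)%:E + 1%:E)%E).
  apply: integrableD => //.
    exact: integrableS If.
  apply: (@measurable_bounded_integrable _ _ _ mu (cst 1)) => //.
    by rewrite /= lebesgue_measure_itv/=; case: ifPn => _; rewrite ?ltry// -EFinB ltry.
  exists 1; split; first exact: num_real.
  by move=> z z1 t _ /=; rewrite normr1 ltW.
apply: le_integrable J => //.
  by apply/measurable_EFinP; apply: measurable_funTS.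
move=> z _; rewrite -EFinD abse_EFin lee_fin.
rewrite [leRHS]ger0_norm; last by rewrite addr_ge0// sqr_ge0.
by have := sqr_ge0 (`|f z| - 2^-1); rewrite -(real_normK (num_real (f z))); nra.
Qed.

Lemma H1_L2 (u g : R -> R) : H1_with_deriv u g -> L2 mu u /\ L2 mu g.
Proof. by case. Qed.

Lemma H1_comb (a b : R) (u g v h : R -> R) :
  H1_with_deriv u g -> H1_with_deriv v h ->
  H1_with_deriv (fun x => a * u x + b * v x) (fun x => a * g x + b * h x).
Proof.
move=> Hu Hv; have [Lu Lg] := H1_L2 Hu; have [Lv Lh] := H1_L2 Hv.
have [? ?] := L2_comb a b Lu Lv; have [? ?] := L2_comb a b Lg Lh.
split=> // x y xy.
have [_ _ _ _ /(_ x y xy) Eu] := Hu; have [_ _ _ _ /(_ x y xy) Ev] := Hv.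
have Ig := L2_integrable_itv x y Lg; have Ih := L2_integrable_itv x y Lh.
rewrite RintegralD//; last 2 first.
- exact: integrable_scale.
- exact: integrable_scale.
rewrite !RintegralZl// -Eu -Ev; ring.
Qed.

(* AM-GM form of Cauchy-Schwarz: the infimum over [t] is the Hoelder-1/2 bound. *)
Lemma H1_modulus (u g : R -> R) (t x y : R) : H1_with_deriv u g -> 0 < t ->
  `|u y - u x| <=
    2^-1 * (t * Rintegral mu setT (fun z => g z ^+ 2) + t^-1 * `|y - x|).
Proof.
move=> Hu t0.
wlog xy : x y / x <= y.
  by move=> H; have [/H//|/ltW/H] := leP x y; rewrite distrC (distrC x).
have [_ Lg] := H1_L2 Hu.
have [_ _ _ Ig2 ->//] := Hu.
have Ig := L2_integrable_itv x y Lg.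
have Ig2' : mu.-integrable `[x, y] (EFin \o (fun z => g z ^+ 2)).
  exact: integrableS Ig2.
have fin_xy : (mu `[x, y] = (y - x)%:E)%E.
  rewrite lebesgue_measure_itv/= lte_fin; move: xy; rewrite le_eqVlt => /predU1P[->|->].
    by rewrite ltxx subrr.
  by rewrite EFinB.
have Icst c : mu.-integrable `[x, y] (EFin \o cst c).
  apply: measurable_bounded_integrable => //; first by rewrite [X in (X < _)%E]fin_xy ltry.
  exists `|c|; split; first exact: num_real.
  by move=> z z1 ? _ /=; rewrite ltW.
have I1 : mu.-integrable `[x, y] (EFin \o (fun z => (2^-1 * t) * g z ^+ 2)).
  exact: integrable_scale.
apply: le_trans (le_normr_Rintegral _ Ig) _ => //.
apply: (@le_trans _ _ (Rintegral mu `[x, y]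
    (fun z => (2^-1 * t) * g z ^+ 2 + 2^-1 * t^-1))).
  apply: le_Rintegral => //.
  - exact: integrable_norm.
  - exact: (@integrableD _ _ _ mu _ _ _ _ I1 (Icst _)).
  move=> z _; rewrite -(real_normK (num_real (g z))).
  have := sqr_ge0 (t * `|g z| - 1) => sq.
  rewrite -(ler_pM2l t0) mulrDr.
  rewrite (_ : t * (2^-1 * t^-1) = 2^-1); last by field; rewrite gt_eqF.
  nra.
rewrite RintegralD//; last exact: Icst.
rewrite RintegralZl// Rintegral_cst//.
rewrite (_ : fine _ = y - x); last exact: (congr1 fine fin_xy).
rewrite (ger0_norm (_ : 0 <= y - x)) ?subr_ge0//.
rewrite [leRHS]mulrDr !mulrA lerD2r ler_wpM2l ?mulr_ge0 ?invr_ge0 ?(ltW t0)//.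
rewrite /Rintegral; apply: fine_le.
- exact: integrable_fin_num.
- exact: integrable_fin_num.
apply: ge0_subset_integral => //.
  by apply/measurable_EFinP; case: Lg => mg _; exact: measurable_funX.
by move=> z _; rewrite lee_fin sqr_ge0.
Qed.

(** A common modulus of continuity carries convergence from the rationals to every point. The
    modulus of [v] is a separate hypothesis since [v] is not yet known to lie in H^1 when this is
    applied. *)
Lemma H1_cvg (u : nat -> R -> R) (g : nat -> R -> R) (v : R -> R) (M : R) :
  (forall n, H1_with_deriv (u n) (g n)) ->
  (forall n, Rintegral mu setT (fun z => g n z ^+ 2) <= M) ->
  (forall t x y, 0 < t -> `|v y - v x| <= 2^-1 * (t * M + t^-1 * `|y - x|)) ->
  (forall q : rat, u ^~ (ratr q) @ \oo --> v (ratr q)) ->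
  forall x, u ^~ x @ \oo --> v x.
Proof.
move=> Hu uM vM uv x; apply/cvgrPdist_lt => e e0.
have M0 : 0 <= M.
  by apply: le_trans (uM 0); apply: Rintegral_ge0 => z _; exact: sqr_ge0.
(* This [t] gives [t * M <= e / 4], and a rational within [t * (e / 4)] of [x] makes the other term
   of the modulus at most [e / 4] too. The [+ 1] covers [M = 0]. *)
pose t := e / 4 / (M + 1).
have t0 : 0 < t by rewrite !divr_gt0// ltr_wpDl.
have tM : t * M <= e / 4.
  rewrite /t mulrAC ler_pdivrMr ?ltr_wpDl// ler_wpM2l//; first by rewrite divr_ge0 ?ltW.
  by rewrite lerDl.
have e40 : 0 < e / 4 by rewrite divr_gt0.
have de0 : 0 < t * (e / 4) by exact: mulr_gt0.
have xt : x < x + t * (e / 4) by rewrite ltrDl.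
have [q] := rat_in_itvoo xt.
rewrite in_itv/= => /andP[xq qx].
have qxle : `|ratr q - x| <= t * (e / 4).
  by rewrite ger0_norm ?subr_ge0 ?(ltW xq)// lerBlDl ltW.
have small (w : R -> R) : `|w (ratr q) - w x| <= 2^-1 * (t * M + t^-1 * `|ratr q - x|) ->
    `|w (ratr q) - w x| <= e / 4.
  move=> /le_trans; apply.
  have : t^-1 * `|ratr q - x| <= e / 4 by rewrite mulrC ler_pdivrMr// mulrC.
  lra.
have /cvgrPdist_lt/(_ _ e40) := uv q; apply: filterS => n Hn.
have h1 := small _ (vM t x (ratr q) t0).
have h2 : `|u n (ratr q) - u n x| <= e / 4.
  apply: small; apply: le_trans (H1_modulus x (ratr q) (Hu n) t0) _.
  apply: ler_wpM2l; first by rewrite invr_ge0.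
  by rewrite lerD2r; apply: ler_wpM2l (uM n); exact: ltW.
rewrite (_ : v x - u n x = (v (ratr q) - u n (ratr q)) +
  ((u n (ratr q) - u n x) - (v (ratr q) - v x))); last by ring.
apply: le_lt_trans (ler_normD _ _) _.
apply: (@lt_le_trans _ _ (e / 4 + (e / 4 + e / 4))); last by lra.
apply: ltr_leD => //; apply: le_trans (ler_normB _ _) _; exact: lerD.
Qed.

End sobolev.

(** * A tent function in K_a *)

Section tent.
Context {R : realType}.
Local Notation mu := (@lebesgue_measure R).

(** Up to a constant, this is the antiderivative of the indicator of [p, q]; combinations of clamps
    thus have explicit weak derivatives. *)
Let clamp (p q x : R) := Num.min (Num.max x p) q.

Let clamp_le (p q x : R) : p <= q -> x <= p -> clamp p q x = p.
Proof. by move=> pq xp; rewrite /clamp max_r// min_l. Qed.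

Let clamp_ge (p q x : R) : q <= x -> clamp p q x = q.
Proof. by move=> qx; rewrite /clamp min_r// le_max qx. Qed.

Let clamp_in (p q x : R) : p <= x -> x <= q -> clamp p q x = x.
Proof. by move=> px xq; rewrite /clamp max_l// min_l. Qed.

Let clamp_Rintegral (p q x y : R) : p <= q -> x <= y ->
  clamp p q y - clamp p q x = Rintegral mu `[x, y] \1_(`[p, q]%classic : set R).
Proof.
move=> pq xy; rewrite /Rintegral integral_indic// -itv_setI/=.
rewrite lebesgue_measure_itv/= lte_fin joinEtotal meetEtotal.
have [yp|py] := leP y p.
  rewrite !clamp_le ?(le_trans xy)// subrr ifF//; apply/negbTE.
  by rewrite -leNgt ge_min !le_max yp !orbT.
have [qx|xq] := leP q x.
  rewrite !clamp_ge ?(le_trans qx)// subrr ifF//; apply/negbTE.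
  by rewrite -leNgt ge_min !le_max qx !orbT.
have le : Num.max p x <= Num.min q y.
  by rewrite ge_max !le_min pq xy (ltW py) (ltW xq).
have -> : clamp p q y - clamp p q x = Num.min q y - Num.max p x.
  rewrite /clamp (max_l (ltW py)) (minC y) (maxC x).
  by rewrite (min_l (_ : Num.max p x <= q))// ge_max pq ltW.
move: le; rewrite le_eqVlt => /predU1P[->|lt]; first by rewrite ltxx subrr.
by rewrite lt.
Qed.

Let L2_indic (p q : R) : L2 mu (\1_(`[p, q]%classic : set R) : R -> R).
Proof.
split; first exact: measurable_indic.
have := @integrable_indic_itv R p q true false.
apply: eq_integrable => //= x _ /=.
by rewrite indicE; case: (_ \in _); rewrite ?expr1n ?expr0n.
Qed.

Let measurable_clamp (p q : R) : measurable_fun [set: Rline R] (clamp p q).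
Proof. by apply: measurable_minr => //; exact: measurable_maxr. Qed.

(** The pointwise form of the norm constraint is stable under midpoints and pointwise limits. *)
Lemma sup_norm1 (a : R) (u : R -> R) :
  u a = 1 -> sup_norm u = 1%E <-> (forall x, `|u x| <= 1).
Proof.
move=> ua; split=> [s1 x|u1].
  by rewrite -lee_fin -[leRHS]/(1%E) -s1; apply: ereal_sup_ubound; exists x.
apply/eqP; rewrite eq_le; apply/andP; split.
  by apply: ge_ereal_sup => _ [x _ <-]; rewrite lee_fin.
by apply: ereal_sup_ubound; exists a => //; rewrite ua normr1.
Qed.

Lemma in_Ka_nonempty (a : R) : exists u g : R -> R, in_Ka a u g.
Proof.
(* The graph rises from 0 at [a - 1] to 1 at [a] and falls back to 0 at [a + 1]. *)
pose u x := clamp (a - 1) a x - clamp a (a + 1) x + 1.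
have out x : x <= a - 1 \/ a + 1 <= x -> u x = 0.
  rewrite /u => -[xa|ax].
    by rewrite !clamp_le; lra.
  by rewrite !clamp_ge; lra.
have u01 x : 0 <= u x <= 1.
  have [xa|ax] := leP x (a - 1); first by rewrite out ?lexx ?ler01//; left.
  have [xa|ax'] := leP x a.
    by apply/andP; rewrite /u clamp_in ?(ltW ax)// clamp_le//; lra.
  have [xa|ax''] := leP x (a + 1).
    by apply/andP; rewrite /u clamp_ge ?(ltW ax')// clamp_in ?(ltW ax')//; lra.
  by rewrite out ?lexx ?ler01//; right; exact: ltW.
have uout x : x \notin `[a - 1, a + 1] -> u x = 0.
  rewrite in_itv/= negb_and -!ltNge => /orP[] /ltW ?; apply: out; [by left|by right].
pose g (x : R) : R := 1 * \1_(`[a - 1, a]%classic : set R) x +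
  (-1) * \1_(`[a, a + 1]%classic : set R) x.
have ua : u a = 1.
  by rewrite /u clamp_ge// clamp_le//; lra.
exists u, g; split=> //; last first.
  apply/(sup_norm1 ua) => x.
  by have /andP[? ?] := u01 x; rewrite ger0_norm.
have [mg Ig] : L2 mu g by apply: L2_comb; exact: L2_indic.
have mu_ : measurable_fun [set: Rline R] u.
  by apply: measurable_funD => //; exact: measurable_funB.
split=> //.
  have [_ J] := L2_indic (a - 1) (a + 1).
  apply: le_integrable J => //.
    by apply/measurable_EFinP; exact: measurable_funX.
  move=> x _; rewrite !abse_EFin lee_fin !ger0_norm ?sqr_ge0// indicE.
  have [xI|xI] := boolP (x \in `[a - 1, a + 1]).
    rewrite mem_set// expr1n; have /andP[? ?] := u01 x; exact: exprn_ile1.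
  by rewrite uout// expr0n sqr_ge0.
move=> x y xy; rewrite RintegralD//; last 2 first.
- exact/integrable_scale/L2_integrable_itv.
- exact/integrable_scale/L2_integrable_itv.
rewrite !RintegralZl//; last 2 first.
- exact: L2_integrable_itv.
- exact: L2_integrable_itv.
rewrite -!clamp_Rintegral//; last 2 first.
- by rewrite lerDl.
- by rewrite gerBl.
rewrite /u; ring.
Qed.
End tent.

(** * Fatou's lemma for real-valued integrals *)

Section fatou.
Context {d : measure_display} {T : measurableType d} {R : realType}.
Variable mu : {measure set T -> \bar R}.

(** Integrability of [g] belongs to the conclusion: were the integral infinite, [Rintegral] would
    default to 0 and the bound would carry no information. *)
Lemma fatou_Rintegral (f : nat -> T -> R) (g : T -> R) (c : nat -> R) (l : R) :
  (forall n, measurable_fun setT (f n)) -> measurable_fun setT g ->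
  (forall n x, 0 <= f n x) -> (forall x, 0 <= g x) ->
  (\forall x \ae mu, f ^~ x @ \oo --> g x) ->
  (forall n, mu.-integrable setT (EFin \o f n)) ->
  (forall n, Rintegral mu setT (f n) <= c n) -> c @ \oo --> l ->
  mu.-integrable setT (EFin \o g) /\ Rintegral mu setT g <= l.
Proof.
move=> mf mg f0 g0 fg If fc cl.
have mfE n : measurable_fun setT (EFin \o f n) by exact/measurable_EFinP.
have mgE : measurable_fun setT (EFin \o g) by exact/measurable_EFinP.
have le_l : (\int[mu]_x (g x)%:E <= l%:E)%E.
  apply: (@le_trans _ _ (\int[mu]_x limn_einf (fun n => (f n x)%:E))%E).
    apply: ae_ge0_le_integral => //.
    - by move=> x _; rewrite lee_fin.
    - move=> x _; rewrite limn_einf_lim; apply: lime_ge; first exact: is_cvg_einfs.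
      apply: nearW => n; apply: le_ereal_inf_tmp => _ [k _ <-].
      by rewrite lee_fin.
    - rewrite (_ : (fun x => _) =
          (fun x => - limn_esup (fun n => - (f n x)%:E)))%E.
        apply: measurableT_comp => //; apply: measurable_fun_limn_esup => n.
        by apply: (measurableT_comp _ (mfE n)); exact: oppe_measurable.
      apply/funext => x.
      by rewrite (limn_esupN (fun n => (f n x)%:E)) oppeK.
    - apply: filterS fg => x fx _.
      have /cvg_limn_einf_sup[-> _] : (fun n => (f n x)%:E) @ \oo --> (g x)%:E.
        by apply: cvg_EFin fx; exact: nearW.
      exact: lexx.
  apply: le_trans (fatou mu measurableT mfE _) _.
    by move=> n x _; rewrite lee_fin.
  have /cvg_limn_einf_sup[<- _] : (fun n => (c n)%:E) @ \oo --> l%:E.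
    by apply: cvg_EFin cl; exact: nearW.
  rewrite !limn_einf_lim; apply: lee_lim; [exact: is_cvg_einfs..|].
  apply: nearW => n; apply: le_ereal_inf_tmp => _ [k nk <-].
  apply: (@le_trans _ _ (\int[mu]_x (f k x)%:E)%E).
    by apply: ereal_inf_lbound; exists k.
  rewrite -[leLHS]fineK ?lee_fin; first exact: fc.
  exact: integrable_fin_num (If k).
have Ig : mu.-integrable setT (EFin \o g).
  apply/integrableP; split=> //.
  under eq_integral do rewrite gee0_abs ?lee_fin//.
  by apply: le_lt_trans le_l _; rewrite ltry.
split=> //; rewrite -lee_fin /Rintegral fineK//.
exact: integrable_fin_num Ig.
Qed.

End fatou.

(** * Near-minimizers on decreasing sets *)

Section nested_inf.
Context {R : realType} {P : Type}.

(** The infima of [J] over the [C n] increase and stay below [M]; [l] is their supremum. Far enough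
    along, values on [C (N n)] cannot drop below [l - eps n], while near-minimizers stay below
    [l + eps n]. *)
Lemma nested_inf (C : nat -> set P) (J : P -> R) (M : R) (eps : nat -> R) :
  (forall n, C n.+1 `<=` C n) -> (forall p, C 0 p -> 0 <= J p) ->
  (forall n, exists2 p, C n p & J p <= M) -> (forall n, 0 < eps n) ->
  exists (l : R) (N : nat -> nat) (z : nat -> P),
    [/\ forall n, (n <= N n)%N, forall n, (N n <= N n.+1)%N,
        forall n, C (N n) (z n) /\ J (z n) <= l + eps n &
        forall n p, C (N n) p -> l - eps n <= J p].
Proof.
move=> CS J0 CM e0.
have Cle n m : (n <= m)%N -> C m `<=` C n.
  elim: m => [|m IHm]; first by rewrite leqn0 => /eqP->.
  by rewrite leq_eqVlt ltnS => /predU1P[->//|/IHm H]; exact: subset_trans (CS m) H.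
pose i n := inf (J @` C n).
have iinf n : has_inf (J @` C n).
  split; first by have [p Cp _] := CM n; exists (J p); exists p.
  by exists 0 => _ [p /(Cle 0%N n (leq0n n)) Cp <-]; exact: J0.
have iM n : i n <= M.
  have [p Cp JM] := CM n; apply: le_trans JM.
  by apply: ge_inf; [have [] := iinf n|exists p].
have supi : has_sup (range i).
  by split; [exists (i 0%N); exists 0%N|exists M => _ [n _ <-]].
pose l := sup (range i).
have /choice[N0 HN0] n : exists k, l - eps n < i k.
  by have [_ [k _ <-] ?] := sup_adherent (e0 n) supi; exists k.
(* Adding a running sum of [N0] makes [N] monotone and at least both [n] and [N0 n]. *)
pose N n := (n + \sum_(0 <= k < n.+1) N0 k)%N.
have N0N n : (N0 n <= N n)%N.
  by rewrite /N big_nat_recr//= addnA leq_addl.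
have /choice[z Hz] n : exists p, C (N n) p /\ J p <= l + eps n.
  have [_ [p Cp <-] Jp] := inf_adherent (e0 n) (iinf (N n)).
  exists p; split=> //; apply: ltW; apply: lt_le_trans Jp _; rewrite lerD2r.
  by apply: ub_le_sup; [have [] := supi|exists (N n)].
exists l, N, z; split=> //.
- by move=> n; exact: leq_addr.
- by move=> n; rewrite /N [in leqRHS]big_nat_recr//= addSn leqW// leq_add2l leq_addr.
- move=> n p /(Cle _ _ (N0N n)) Cp; apply: le_trans (ltW (HN0 n)) _.
  by apply: ge_inf; [have [] := iinf (N0 n)|exists p].
Qed.

End nested_inf.

(** * The convex part of the functional *)

Section energy.
Context {R : realType}.
Local Notation mu := (@lebesgue_measure R).
Variables (W : R -> R) (c C : R).
Hypotheses (mW : measurable_fun [set: Rline R] W) (c0 : 0 < c).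
Hypothesis Wc : forall x, c <= W x <= C.

Let W0 x : 0 <= W x.
Proof. by have /andP[/(lt_le_trans c0)/ltW] := Wc x. Qed.

Definition energy (v h : R -> R) : R :=
  Rintegral mu setT (fun x => h x ^+ 2 + W x * v x ^+ 2).

Lemma weight_integrable (v : R -> R) : L2 mu v ->
  mu.-integrable setT (EFin \o (fun x => W x * v x ^+ 2)).
Proof.
move=> [mv Iv].
have J : mu.-integrable setT (EFin \o (fun x => C * v x ^+ 2)).
  exact: integrable_scale.
apply: le_integrable J => //.
  by apply/measurable_EFinP; apply: measurable_funM => //; exact: measurable_funX.
move=> x _; rewrite /= lee_fin !normrM ler_wpM2r//.
by have /andP[_ WC] := Wc x; rewrite !ger0_norm// (le_trans (W0 x)).
Qed.

Lemma energy_integrable (v h : R -> R) : L2 mu v -> L2 mu h ->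
  mu.-integrable setT (EFin \o (fun x => h x ^+ 2 + W x * v x ^+ 2)).
Proof.
move=> Lv [mh Ih].
exact: (@integrableD _ _ _ mu _ _ _ _ Ih (weight_integrable Lv)).
Qed.

Lemma energy_ge0 (v h : R -> R) : 0 <= energy v h.
Proof.
apply: Rintegral_ge0 => x _; rewrite addr_ge0 ?sqr_ge0//.
by rewrite mulr_ge0// sqr_ge0.
Qed.

Lemma le_energy (v h : R -> R) : L2 mu v -> L2 mu h ->
  Rintegral mu setT (fun x => h x ^+ 2) <= energy v h.
Proof.
move=> Lv Lh; apply: le_Rintegral => //; first by case: Lh.
- exact: energy_integrable.
- by move=> x _; rewrite lerDl mulr_ge0// sqr_ge0.
Qed.

(** Pointwise, the integrand on the right exceeds the one on the left by W (u - v)^2, which is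
    nonnegative. So two near-minimizers whose midpoint is admissible have close derivatives. *)
Lemma energy_parallelogram (u g v h : R -> R) :
  L2 mu u -> L2 mu g -> L2 mu v -> L2 mu h ->
  Rintegral mu setT (fun x => (h x - g x) ^+ 2) <=
    2 * (energy u g + energy v h) -
    4 * energy (fun x => 2^-1 * u x + 2^-1 * v x) (fun x => 2^-1 * g x + 2^-1 * h x).
Proof.
move=> Lu Lg Lv Lh.
have Lm := L2_comb 2^-1 2^-1 Lu Lv; have Lm' := L2_comb 2^-1 2^-1 Lg Lh.
have Lk : L2 mu (fun x => h x - g x).
  by have := L2_comb 1 (-1) Lh Lg; congr L2; apply/funext => x; rewrite mul1r mulN1r.
rewrite lerBrDr /energy.
have I1 := energy_integrable Lu Lg; have I2 := energy_integrable Lv Lh.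
have I3 := energy_integrable Lm Lm'.
have I12 := integrableD measurableT I1 I2.
have I4 := integrable_scale 4 measurableT I3.
have Ik : mu.-integrable setT (EFin \o (fun x => (h x - g x) ^+ 2)) by case: Lk.
rewrite -RintegralD// -!RintegralZl// -RintegralD//.
apply: le_Rintegral => //.
- exact: (@integrableD _ _ _ mu _ _ _ _ Ik I4).
- exact: integrable_scale.
move=> x _; rewrite -subr_ge0.
set a := u x; set b := v x; set y := g x; set z := h x.
rewrite (_ : _ - _ = W x * (a - b) ^+ 2); last by field.
by rewrite mulr_ge0// sqr_ge0.
Qed.

End energy.

(** * The direct method on K_a *)

Section minimization.
Context {R : realType}.
Local Notation mu := (@lebesgue_measure R).

(** The identity between increments and integrals passes to the limit by dominated convergence on
    [x, y], with majorant |h 0| + S + 1, where boundedness of the interval makes the constant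
    integrable. *)
Lemma H1_limit (v h : nat -> R -> R) (u g : R -> R) (S : R -> \bar R) :
  (forall n, H1_with_deriv (v n) (h n)) -> L2 mu u -> L2 mu g ->
  (forall x, v ^~ x @ \oo --> u x) ->
  (\forall x \ae mu, h ^~ x @ \oo --> g x) ->
  mu.-integrable [set: Rline R] S ->
  (forall n x, (`|h n x - h 0 x|%:E <= S x + 1)%E) ->
  H1_with_deriv u g.
Proof.
move=> Hvh [mu_ Iu] [mg Ig] vu hg IS hS; split=> // x y xy.
have Lh n : L2 mu (h n) by have [] := H1_L2 (Hvh n).
have mD (f : R -> R) : measurable_fun [set: Rline R] f ->
    measurable_fun (`[x, y]%classic : set (Rline R)) (EFin \o f).
  by move=> mf; apply/measurable_EFinP; exact: measurable_funTS.
have I1 : mu.-integrable `[x, y] (EFin \o cst 1).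
  apply: measurable_bounded_integrable => //.
    rewrite /= lebesgue_measure_itv/=.
    by case: ifPn => _; rewrite ?ltry// -EFinB ltry.
  exists 1; split; first exact: num_real.
  by move=> z z1 t _ /=; rewrite normr1 ltW.
have Idom : mu.-integrable `[x, y] (fun z => `|h 0%N z|%:E + (S z + (cst 1 z)%:E))%E.
  apply: integrableD => //.
    exact: (integrable_norm (L2_integrable_itv x y (Lh 0%N))).
  apply: integrableD => //; exact: integrableS IS.
have [Igxy _ H] : [/\ mu.-integrable `[x, y] (EFin \o g),
  [sequence \int[mu]_(z in `[x, y]) `|(h n z)%:E - (g z)%:E|]_n @ \oo --> 0 &
  [sequence \int[mu]_(z in `[x, y]) (h n z)%:E]_n @ \oo -->
    \int[mu]_(z in `[x, y]) (g z)%:E]%E.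
  apply: (@dominated_convergence _ _ _ mu _ _ (fun n => EFin \o h n) _ _ _ _ _ Idom) => //.
  - by move=> n; apply: mD; case: (Lh n).
  - exact: mD.
  - move: hg; apply: (@filterS _ _ (ae_filter_ringOfSetsType mu)) => z hz _ /=.
    by apply: cvg_EFin hz; exact: nearW.
  - apply: aeW => z n _ /=.
    apply: (@le_trans _ _ (`|h 0%N z|%:E + `|h n z - h 0%N z|%:E)%E).
      by rewrite -EFinD lee_fin -{1}(subrK (h 0%N z) (h n z)) addrC ler_normD.
    by rewrite leeD2l.
have cD : (fun n => v n y - v n x) @ \oo --> u y - u x by apply: cvgB.
have E n : v n y - v n x = Rintegral mu `[x, y] (h n).
  by have [_ _ _ _ ->] := Hvh n.
have : (fun n => v n y - v n x) @ \oo --> Rintegral mu `[x, y] g.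
  under eq_fun do rewrite E.
  rewrite /Rintegral; apply: fine_cvg.
  by rewrite fineK//; exact: integrable_fin_num Igxy.
by apply: cvg_unique cD; exact: norm_hausdorff.
Qed.

Lemma in_Ka_le1 (a : R) (u g : R -> R) : in_Ka a u g -> forall x, `|u x| <= 1.
Proof. by case=> _ ua /(sup_norm1 ua). Qed.

Lemma in_Ka_midpoint (a : R) (u g v h : R -> R) :
  in_Ka a u g -> in_Ka a v h ->
  in_Ka a (fun x => 2^-1 * u x + 2^-1 * v x) (fun x => 2^-1 * g x + 2^-1 * h x).
Proof.
move=> Ku Kv; have u1 := in_Ka_le1 Ku; have v1 := in_Ka_le1 Kv.
have [Hu ua _] := Ku; have [Hv va _] := Kv.
have E : 2^-1 * u a + 2^-1 * v a = 1 by rewrite ua va; lra.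
split=> //; first exact: H1_comb.
apply/(sup_norm1 (u := fun x => 2^-1 * u x + 2^-1 * v x) E) => x.
apply: le_trans (ler_normD _ _) _.
rewrite !normrM (ger0_norm (_ : 0 <= 2^-1)) ?invr_ge0//.
by have := u1 x; have := v1 x; lra.
Qed.

Variables (W : R -> R) (c C : R) (nu : {charge set Rline R -> \bar R}).
Hypotheses (mW : measurable_fun [set: Rline R] W) (c0 : 0 < c).
Hypothesis Wc : forall x, c <= W x <= C.

(** This is [Ifun] with the potential density replaced by [W], whose bounds hold everywhere. *)
Let functional (v h : R -> R) : R :=
  energy W v h + charge_integral nu (fun x => v x * v x).

Let halfpow_gt0 n : 0 < 2^-1 ^+ n :> R. Proof. by rewrite exprn_gt0. Qed.

Let halfpow_le1 n : 2^-1 ^+ n <= 1 :> R.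
Proof. by apply: exprn_ile1; lra. Qed.

Let halfpow_cvg : (fun n => 2^-1 ^+ n : R) @ \oo --> (0 : R).
Proof. by apply: cvg_expr; rewrite ger0_norm; lra. Qed.

Lemma energy_minimizer (a : R) : exists u g : R -> R, in_Ka a u g /\
  forall v h, in_Ka a v h -> functional u g <= functional v h.
Proof.
have [Q HQ] := charge_integral_bounded nu 1.
have mK v h : in_Ka a v h -> measurable_fun [set: Rline R] v by case=> -[].
have Ksq v h : in_Ka a v h -> forall x, `|v x * v x| <= 1.
  by move=> K x; rewrite normrM mulr_ile1// (in_Ka_le1 K).
have Kcharge v h : in_Ka a v h -> `|charge_integral nu (fun x => v x * v x)| <= Q.
  move=> K; apply: HQ; last exact: (Ksq _ _ K).
  by apply: measurable_funM; exact: mK K.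
have W0 x : 0 <= W x by have /andP[/(lt_le_trans c0)/ltW] := Wc x.
have E0 v h : 0 <= energy W v h by exact: (energy_ge0 c0 Wc).
pose F := [set r | exists v h, in_Ka a v h /\ r = functional v h].
have infF : has_inf F.
  split.
    by have [v [h K]] := in_Ka_nonempty a; exists (functional v h), v, h.
  exists (- Q) => _ [v [h [K ->]]]; have := Kcharge v h K.
  by rewrite ler_norml /functional => /andP[? _]; have := E0 v h; lra.
pose m := inf F.
have mle v h : in_Ka a v h -> m <= functional v h.
  by move=> K; apply: ge_inf; [have [] := infF|exists v, h].
have /choice[p Hp] n : exists p : (R -> R) * (R -> R),
    in_Ka a p.1 p.2 /\ functional p.1 p.2 <= m + 2^-1 ^+ n.
  have [_ [v [h [K ->]]] lt] := inf_adherent (halfpow_gt0 n) infF.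
  by exists (v, h); split=> //; exact: ltW.
have pK n := (Hp n).1.
(* The functional is at most [m + 1] along [p], and the charge term is at least [- Q]. *)
pose M := m + 1 + Q.
have pM n : energy W (p n).1 (p n).2 <= M.
  have := Kcharge _ _ (pK n); rewrite ler_norml => /andP[h1 _].
  have h2 := halfpow_le1 n.
  by have := (Hp n).2; rewrite /functional /M; lra.
have LK v h : in_Ka a v h -> L2 mu v /\ L2 mu h by case=> /H1_L2.
have dE v h : in_Ka a v h ->
    Rintegral mu setT (fun x => h x ^+ 2) <= energy W v h.
  by move=> /LK[Lv Lh]; exact: (le_energy mW c0 Wc).
have [u clu] := pointwise_cluster (fun n => in_Ka_le1 (pK n)).
(* The modulus of the sequence passes to [u], because a single [p n] is close to [u] at both [x] and
   [y]. *)
have umod t x y : 0 < t -> `|u y - u x| <= 2^-1 * (t * M + t^-1 * `|y - x|).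
  move=> t0; apply/ler_addgt0Pr => e e0.
  have e20 : 0 < e / 2 by rewrite divr_gt0.
  have [n _ Hn] := clu [:: x; y] _ 0%N e20.
  have hx := Hn x (mem_head _ _).
  have hy : `|(p n).1 y - u y| < e / 2 by apply: Hn; rewrite !inE eqxx orbT.
  have [Hpn _ _] := pK n.
  have H1 := H1_modulus x y Hpn t0.
  have H2 : 2^-1 * (t * Rintegral mu setT (fun z => (p n).2 z ^+ 2) + t^-1 * `|y - x|)
      <= 2^-1 * (t * M + t^-1 * `|y - x|).
    apply: ler_wpM2l; first by rewrite invr_ge0.
    rewrite lerD2r; apply: ler_wpM2l; first exact: ltW.
    exact: le_trans (dE _ _ (pK n)) (pM n).
  rewrite (_ : u y - u x = ((p n).1 y - (p n).1 x) +
    (((p n).1 x - u x) - ((p n).1 y - u y))); last by ring.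
  apply: le_trans (ler_normD _ _) _; apply: lerD; first exact: le_trans H2.
  apply: le_trans (ler_normB _ _) _; lra.
(* This enumerates the rationals; indices that encode no rational give 0, a harmless repetition. *)
pose q i : R := ratr (odflt 0 (unpickle i)).
pose CC n : set ((R -> R) * (R -> R)) := [set z | in_Ka a z.1 z.2 /\
  forall i, (i <= n)%N -> `|z.1 (q i) - u (q i)| <= 2^-1 ^+ n].
have CS n : CC n.+1 `<=` CC n.
  move=> z [K Hz]; split=> // i iN.
  apply: le_trans (Hz i (leqW iN)) _; rewrite exprS.
  by have := halfpow_gt0 n; lra.
have Cle n k : (n <= k)%N -> CC k `<=` CC n.
  elim: k => [|k IHk]; first by rewrite leqn0 => /eqP->.
  by rewrite leq_eqVlt ltnS => /predU1P[->//|/IHk H]; exact: subset_trans (CS k) H.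
have Cmid n y z : CC n y -> CC n z ->
    CC n (fun x => 2^-1 * y.1 x + 2^-1 * z.1 x, fun x => 2^-1 * y.2 x + 2^-1 * z.2 x).
  move=> [Ky Hy] [Kz Hz]; split=> /=; first exact: in_Ka_midpoint.
  move=> i iN; rewrite (_ : _ - _ = 2^-1 * (y.1 (q i) - u (q i)) +
    2^-1 * (z.1 (q i) - u (q i))); last by field.
  apply: le_trans (ler_normD _ _) _.
  rewrite !normrM (ger0_norm (_ : 0 <= 2^-1)) ?invr_ge0//.
  by have := Hy i iN; have := Hz i iN; lra.
(* As [n <= f n], the reindexed sequence [w] is still minimizing, and now [w n] lies in [CC n]. *)
have /choice[f Hf] n : exists k, (n <= k)%N /\ CC n (p k).
  have [k nk Hk] := clu [seq q i | i <- iota 0 n.+1] _ n (halfpow_gt0 n).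
  exists k; split=> //; split; first exact: pK.
  by move=> i iN; apply/ltW/Hk/map_f; rewrite mem_iota.
pose w n := p (f n).
have wC n : CC n (w n) by have [] := Hf n.
(* The tolerance is 4^-n because [L2_fast_cauchy] asks for squared distances of that order. *)
have [l [N [z [nN Nmono Hz Hl]]]] : exists l N z,
    [/\ forall n, (n <= N n)%N, forall n, (N n <= N n.+1)%N,
        forall n, CC (N n) (z n) /\
          energy W (z n).1 (z n).2 <= l + (2^-1 ^+ n) ^+ 2 &
        forall n y, CC (N n) y -> l - (2^-1 ^+ n) ^+ 2 <= energy W y.1 y.2].
  apply: (@nested_inf _ _ CC (fun y => energy W y.1 y.2) M) => //.
  by move=> n; exists (w n); [exact: wC|exact: pM].
have zK n : in_Ka a (z n).1 (z n).2 by have [[]] := Hz n.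
have qcvg (y : nat -> (R -> R) * (R -> R)) : (forall n, CC n (y n)) ->
    forall r : rat, (fun n => (y n).1 (ratr r)) @ \oo --> u (ratr r).
  move=> yC r; apply/cvgrPdist_le => e e0.
  have /cvgrPdist_le/(_ e e0) [k _ Hk] := halfpow_cvg.
  exists (maxn k (pickle r)) => // n /=; rewrite geq_max => /andP[kn rn].
  have := Hk n kn; rewrite sub0r normrN ger0_norm ?(ltW (halfpow_gt0 n))//.
  have [_ /(_ (pickle r) rn)] := yC n.
  by rewrite /q pickleK/= distrC; exact: le_trans.
have H1K v h : in_Ka a v h -> H1_with_deriv v h by case.
have wcvg x : (fun n => (w n).1 x) @ \oo --> u x.
  apply: (@H1_cvg _ (fun n => (w n).1) (fun n => (w n).2) _ M) => //.
  - by move=> n; apply: H1K; exact: pK.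
  - by move=> n; exact: le_trans (dE _ _ (pK _)) (pM _).
  - exact: qcvg wC.
(* The energies of [z] are bounded by [l + 1], the modulus of [u] uses [M]; the maximum serves
   both. *)
have zcvg x : (fun n => (z n).1 x) @ \oo --> u x.
  apply: (@H1_cvg _ (fun n => (z n).1) (fun n => (z n).2) _ (Num.max M (l + 1))) => //.
  - by move=> n; apply: H1K; exact: zK.
  - move=> n; apply: le_trans (dE _ _ (zK _)) _.
    apply: le_trans (Hz n).2 _; rewrite le_max lerD2l; apply/orP; right.
    exact: exprn_ile1 (ltW (halfpow_gt0 n)) (halfpow_le1 n).
  - move=> t x' y t0; apply: le_trans (umod t x' y t0) _.
    apply: ler_wpM2l; first by rewrite invr_ge0.
    by rewrite lerD2r ler_wpM2l ?(ltW t0)// le_max lexx.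
  - by apply: qcvg => n; apply: Cle (nN n) _ (Hz n).1.
have Lz n := LK _ _ (zK n).
(* Both functions and their midpoint lie in [CC (N n)]. With e_n = 4^-n the parallelogram law bounds
   the left side by 2 (2 l + e_n + e_(n+1)) - 4 (l - e_n) = 6.5 e_n, below 8 e_n. *)
have fast n : (\int[mu]_x (((z n.+1).2 x - (z n).2 x) ^+ 2)%:E <=
    (8 * (2^-1 ^+ n) ^+ 2)%:E)%E.
  have [Lz1 Lz2] := Lz n; have [Lz1' Lz2'] := Lz n.+1.
  have Ld : L2 mu (fun x => (z n.+1).2 x - (z n).2 x).
    have := L2_comb 1 (-1) Lz2' Lz2; congr L2.
    by apply/funext => x; rewrite mul1r mulN1r.
  rewrite -[leLHS]fineK; last by case: Ld => _ /integrable_fin_num; apply.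
  rewrite lee_fin.
  apply: le_trans (energy_parallelogram mW c0 Wc Lz1 Lz2 Lz1' Lz2') _.
  have := Hl n _ (Cmid _ _ _ (Hz n).1 (Cle _ _ (Nmono n) _ (Hz n.+1).1)) => /=.
  have := (Hz n).2; have := (Hz n.+1).2; rewrite (exprS _ n).
  have := sqr_ge0 (2^-1 ^+ n : R); rewrite exprMn => ? ? ? ?; lra.
have [g [S [mg IS hg hS]]] := @L2_fast_cauchy _ _ _ mu
  (fun n => (z n).2) 8 (fun n => (Lz n).2.1) fast.
have mu_ : measurable_fun [set: Rline R] u.
  by apply: (measurable_fun_cvg (fun n => (Lz n).1.1)) => x _; exact: zcvg.
have [IE El] : mu.-integrable setT (EFin \o (fun x => g x ^+ 2 + W x * u x ^+ 2)) /\
    energy W u g <= l.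
  apply: (@fatou_Rintegral _ _ _ mu
    (fun n x => (z n).2 x ^+ 2 + W x * (z n).1 x ^+ 2) _
    (fun n => l + (2^-1 ^+ n) ^+ 2)).
  - move=> n; apply: measurable_funD; first exact: (measurable_funX _ (Lz n).2.1).
    by apply: measurable_funM => //; exact: (measurable_funX _ (Lz n).1.1).
  - apply: measurable_funD; first exact: measurable_funX.
    by apply: measurable_funM => //; exact: measurable_funX.
  - by move=> n x; rewrite addr_ge0 ?sqr_ge0// mulr_ge0// sqr_ge0.
  - by move=> x; rewrite addr_ge0 ?sqr_ge0// mulr_ge0// sqr_ge0.
  - move: hg; apply: (@filterS _ _ (ae_filter_ringOfSetsType mu)) => x hx; apply: cvgD.
      by rewrite expr2; under eq_fun do rewrite expr2; exact: cvgM.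
    apply: cvgM; first exact: cvg_cst.
    by rewrite expr2; under eq_fun do rewrite expr2; apply: cvgM; exact: zcvg.
  - by move=> n; have [? ?] := Lz n; exact: (energy_integrable mW c0 Wc).
  - by move=> n; exact: (Hz n).2.
  - rewrite -[X in _ --> X]addr0; apply: cvgD; first exact: cvg_cst.
    rewrite -(mulr0 (0 : R)); under eq_fun do rewrite expr2.
    by apply: cvgM; exact: halfpow_cvg.
have Lg : L2 mu g.
  split=> //; apply: le_integrable IE => //.
    by apply/measurable_EFinP; exact: measurable_funX.
  move=> x _; rewrite !abse_EFin lee_fin !ger0_norm ?sqr_ge0//.
    by rewrite lerDl mulr_ge0// sqr_ge0.
  by rewrite addr_ge0 ?sqr_ge0// mulr_ge0// sqr_ge0.
(* The lower bound on [W] enters here: c u^2 is at most the energy density. *)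
have Lu : L2 mu u.
  split=> //; apply: le_integrable (integrable_scale c^-1 measurableT IE) => //.
    by apply/measurable_EFinP; exact: measurable_funX.
  move=> x _; rewrite !abse_EFin lee_fin !ger0_norm ?sqr_ge0//.
    rewrite mulrC ler_pdivlMr//.
    have /andP[cW _] := Wc x.
    have := ler_wpM2r (sqr_ge0 (u x)) cW; have := sqr_ge0 (g x); lra.
  rewrite mulr_ge0 ?invr_ge0 ?(ltW c0)//.
  by rewrite addr_ge0 ?sqr_ge0// mulr_ge0// sqr_ge0.
have ua : u a = 1.
  have z1 n : (z n).1 a = 1 by have [] := zK n.
  have := zcvg a; under eq_fun do rewrite z1.
  by move=> /(cvg_lim (@norm_hausdorff _ R)) <-; exact: lim_cst.
have u1 x : `|u x| <= 1.
  have zx : (fun n => `|(z n).1 x|) @ \oo --> `|u x| by apply: cvg_norm; exact: zcvg.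
  rewrite -(cvg_lim (@norm_hausdorff _ R) zx)//; apply: limr_le.
    by apply/cvg_ex; exists `|u x|.
  by apply: nearW => n; exact: (in_Ka_le1 (zK n)).
have Ku : in_Ka a u g.
  split=> //; last exact/(sup_norm1 ua).
  by apply: (H1_limit (fun n => H1K _ _ (zK n)) Lu Lg zcvg hg IS hS).
exists u, g; split=> // v h Kv; apply: le_trans (mle v h Kv).
have ccvg : (fun n => charge_integral nu (fun x => (w n).1 x * (w n).1 x)) @ \oo -->
    charge_integral nu (fun x => u x * u x).
  apply: (@charge_integral_cvg _ _ 1).
  - by move=> n; apply: measurable_funM; exact: mK (pK _).
  - by move=> n; exact: (Ksq _ _ (pK _)).
  - by move=> x; apply: cvgM; exact: wcvg.
apply/ler_addgt0Pr => e e0.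
have e30 : 0 < e / 3 by rewrite divr_gt0.
have /cvgrPdist_le/(_ _ e30) [k1 _ Hk1] := halfpow_cvg.
have /cvgrPdist_le/(_ _ e30) [k2 _ Hk2] := ccvg.
pose k := maxn k1 k2.
have pow_le j : (k1 <= j)%N -> 2^-1 ^+ j <= e / 3.
  by move=> /Hk1; rewrite /= sub0r normrN ger0_norm// ltW.
have kN : (k <= N k)%N by exact: nN.
have k1k : (k1 <= k)%N by rewrite leq_maxl.
have k2k : (k2 <= k)%N by rewrite leq_maxr.
(* The chain is energy of [u] <= [l] <= energy of [w (N k)] + 4^-k. The three errors, from this gap,
   from near-minimality of [w (N k)] and from the charge term, are at most [e / 3] each. *)
have A1 := Hl k _ (wC (N k)).
have A2 := (Hp (f (N k))).2; rewrite -/(w (N k)) in A2.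
have A3 : 2^-1 ^+ f (N k) <= e / 3.
  apply: pow_le; apply: leq_trans k1k (leq_trans kN _).
  by have [] := Hf (N k).
have A4 : (2^-1 ^+ k) ^+ 2 <= e / 3.
  apply: le_trans (pow_le k k1k); rewrite expr2.
  have := halfpow_gt0 k; have := halfpow_le1 k; nra.
have := Hk2 (N k) (leq_trans k2k kN); rewrite /= ler_norml => /andP[_ A5].
by rewrite /functional in A2 *; lra.
Qed.

End minimization.

(** [V0] enters only through a Lebesgue integral, so an almost everywhere equal version may replace
    it; the charge term is untouched. *)
Lemma Ifun_energy (R : realType) (V0 W : R -> R) (c C : R)
  (nu : {charge set Rline R -> \bar R}) (v h : R -> R) :
  measurable_fun [set: Rline R] V0 -> measurable_fun [set: Rline R] W ->
  0 < c -> (forall x, c <= W x <= C) ->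
  (\forall x \ae (@lebesgue_measure R), V0 x = W x) ->
  H1_with_deriv v h ->
  Ifun V0 nu v h = energy W v h + charge_integral nu (fun x => v x * v x).
Proof.
move=> mV mW c0 Wc VW /H1_L2[Lv Lh]; rewrite /Ifun /Vform addrA; congr (_ + _).
have IW := weight_integrable mW c0 Wc Lv.
rewrite /energy RintegralD//; last by case: Lh.
congr (_ + _); rewrite /Rintegral; congr fine.
have [mv _] := Lv; apply: ae_eq_integral => //.
- apply/measurable_EFinP; apply: measurable_funM => //.
  exact: measurable_funM.
- by apply/measurable_EFinP; apply: measurable_funM => //; exact: measurable_funX.
- move: VW; apply: (@filterS _ _ (ae_filter_ringOfSetsType (@lebesgue_measure R))).
  by move=> x VWx _; rewrite VWx expr2 mulrA.
Qed.

Theorem theorem5p2 (R : realType) (V0 : R -> R)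
  (V1 : {charge set Rline R -> \bar R}) :
  measurable_fun [set: Rline R] V0 ->
  (exists C : R, \forall x \ae (@lebesgue_measure R), `|V0 x| <= C) ->
  (exists c : R, 0 < c /\ \forall x \ae (@lebesgue_measure R), c <= V0 x) ->
  forall a : R,
  exists ua ga : R -> R,
    in_Ka a ua ga /\
    forall v h : R -> R, in_Ka a v h -> Ifun V0 V1 ua ga <= Ifun V0 V1 v h.
Proof.
move=> mV [C VC] [c [c0 cV]] a.
(* [W] is a version of [V0] for which the a.e. bounds hold everywhere. *)
pose W x := Num.max c (Num.min (Num.max c C) (V0 x)).
have mW : measurable_fun [set: Rline R] W.
  by apply: measurable_maxr => //; exact: measurable_minr.
have Wc x : c <= W x <= Num.max c C.
  apply/andP; split; first by rewrite le_max lexx.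
  by rewrite ge_max ge_min lexx andbT le_max lexx.
have VW : \forall x \ae (@lebesgue_measure R), V0 x = W x.
  have F := ae_filter_ringOfSetsType (@lebesgue_measure R).
  apply: (@filterS2 _ _ F _ _ _ _ VC cV) => x VxC cVx.
  have VxC' : V0 x <= Num.max c C.
    by rewrite le_max (le_trans (ler_norm _) VxC) orbT.
  by rewrite /W (min_r VxC') max_r.
have [u [g [K umin]]] := energy_minimizer V1 mW c0 Wc a.
exists u, g; split=> // v h Kv.
have [Hu _ _] := K; have [Hv _ _] := Kv.
by rewrite !(Ifun_energy V1 mV mW c0 Wc VW)//; exact: umin.
Qed.
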